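(* Let $\mathbf{k}$ be a commutative unitary ring and let $V$ be a $\mathbf{k}$-module. Then the maps $$\Phi^{\mathrm{alg}}_{1,V}:\mathbf{O}^{\mathrm{alg}}_1(V,-)\to\mathbf{DT}(V),\quad \alpha\mapsto(V,\prec_\alpha,\succ_\alpha,\cdot_\alpha),\qquad\text{and}\qquad \Phi^{\mathrm{mod}}_V:\mathbf{O}^{\mathrm{mod}}(V,-)\to\mathbf{DD}(V),\quad \alpha\mapsto(V,\prec_\alpha,\succ_\alpha),$$ are surjective. Here $\mathbf{O}^{\mathrm{alg}}_1(V,-)$ is the collection of all $\mathcal{O}$-operators $\alpha:R\to A$ on the algebra $R$ of weight $1$, where $A=(A,\ast)$ runs through all $\mathbf{k}$-algebras and $R=(R,\circ,\ell,r)$ runs through all $A$-bimodule $\mathbf{k}$-algebras whose underlying $\mathbf{k}$-module is $V$; $\mathbf{O}^{\mathrm{mod}}(V,-)$ is the collection of all $\mathcal{O}$-operators $\alpha:V\to A$ on the module $V$, where $A$ runs through all $\mathbf{k}$-algebras and $V$ carries an $A$-bimodule structure $(V,\ell,r)$; $\mathbf{DT}(V)$ (resp. $\mathbf{DD}(V)$) is the set of all dendriform trialgebra (resp. dendriform dialgebra) structures on $V$; and $u\prec_\alpha v=u\,r(\alpha(v))$, $u\succ_\alpha v=\ell(\alpha(u))v$ and, in the algebra case of weight $1$, $u\cdot_\alpha v=u\circ v$, for $u,v\in V$.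
   Context: A $\mathbf{k}$-algebra means an associative, not necessarily unitary, $\mathbf{k}$-algebra. Bimodules. For a $\mathbf{k}$-algebra $(A,\ast)$, an $A$-bimodule $(V,\ell,r)$ is a $\mathbf{k}$-module $V$ with $\mathbf{k}$-linear maps $\ell,r:A\to\mathrm{End}_{\mathbf{k}}(V)$, where $r(x)$ is written on the right of its argument ($v\,r(x)$ denotes $r(x)$ applied to $v$), such that for all $x,y\in A$, $v\in V$: $\ell(x\ast y)v=\ell(x)(\ell(y)v)$, $v\,r(x\ast y)=(v\,r(x))\,r(y)$, $(\ell(x)v)\,r(y)=\ell(x)(v\,r(y))$. No unit condition is imposed. An $A$-bimodule $\mathbf{k}$-algebra $(R,\circ,\ell,r)$ is a $\mathbf{k}$-algebra $(R,\circ)$ together with an $A$-bimodule structure $(R,\ell,r)$ such that for all $x\in A$, $v,w\in R$: $\ell(x)(v\circ w)=(\ell(x)v)\circ w$, $(v\circ w)\,r(x)=v\circ(w\,r(x))$, $(v\,r(x))\circ w=v\circ(\ell(x)w)$. $\mathcal{O}$-operators. Given an $A$-bimodule $(V,\ell,r)$, a $\mathbf{k}$-linear map $\alpha:V\to A$ is an $\mathcal{O}$-operator on the module $V$ if $\alpha(u)\ast\alpha(v)=\alpha(\ell(\alpha(u))v)+\alpha(u\,r(\alpha(v)))$ for all $u,v\in V$. Given an $A$-bimodule $\mathbf{k}$-algebra $(R,\circ,\ell,r)$ and $\lambda\in\mathbf{k}$, a $\mathbf{k}$-linear map $\alpha:R\to A$ is an $\mathcal{O}$-operator on the algebra $R$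 of weight $\lambda$ if $\alpha(u)\ast\alpha(v)=\alpha(\ell(\alpha(u))v)+\alpha(u\,r(\alpha(v)))+\lambda\,\alpha(u\circ v)$ for all $u,v\in R$. A dendriform dialgebra is a $\mathbf{k}$-module $D$ with bilinear operations $\prec,\succ$ such that, with $x\star y=x\prec y+x\succ y$, for all $x,y,z\in D$: $(x\prec y)\prec z=x\prec(y\star z)$, $(x\succ y)\prec z=x\succ(y\prec z)$, $x\succ(y\succ z)=(x\star y)\succ z$. A dendriform trialgebra is a $\mathbf{k}$-module $T$ with bilinear operations $\prec,\succ,\cdot$ such that, with $x\star y=x\prec y+x\succ y+x\cdot y$, for all $x,y,z\in T$: $(x\prec y)\prec z=x\prec(y\star z)$, $(x\succ y)\prec z=x\succ(y\prec z)$, $(x\star y)\succ z=x\succ(y\succ z)$, $(x\succ y)\cdot z=x\succ(y\cdot z)$, $(x\prec y)\cdot z=x\cdot(y\succ z)$, $(x\cdot y)\prec z=x\cdot(y\prec z)$, $(x\cdot y)\cdot z=x\cdot(y\cdot z)$. It is known that the products $\prec_\alpha,\succ_\alpha,\cdot_\alpha$ (resp. $\prec_\alpha,\succ_\alpha$) in the claim do define a dendriform trialgebra (resp. dialgebra), so that the two maps are well defined. *)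

(* Defs.v *)
From HB Require Import structures.
From mathcomp Require Import all_boot all_algebra.

Set Implicit Arguments.
Unset Strict Implicit.
Unset Printing Implicit Defensive.

Import GRing.Theory.
Local Open Scope ring_scope.

(* The base ring is a [comPzRingType], so that the zero ring is allowed; the
   library's [bilinear_for] is restricted to nonzero rings. *)
Definition is_bilinear (k : comPzRingType) (U V W : lmodType k)
    (f : U -> V -> W) : Prop :=
  (forall v, linear (f^~ v)) /\ (forall u, linear (f u)).

(* Associative algebras, without any unit condition. *)
Record kalgebra (k : comPzRingType) := KAlgebra {
  kalg_sort :> lmodType k;
  kalg_mul : kalg_sort -> kalg_sort -> kalg_sort;
  kalg_bilinear : is_bilinear kalg_mul;
  kalg_assoc : forall x y z,
    kalg_mul (kalg_mul x y) z = kalg_mul x (kalg_mul y z)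
}.

(* [lact x v] is l(x) v and [ract x v] is v r(x).  Bilinearity says that each
   l(x) and r(x) is an endomorphism of V and that l and r are linear in x. *)
Record bimodule (k : comPzRingType) (A : kalgebra k) (V : lmodType k) :=
  Bimodule {
  lact : A -> V -> V;
  ract : A -> V -> V;
  lact_bilinear : is_bilinear lact;
  ract_bilinear : is_bilinear ract;
  lactM : forall x y v, lact (kalg_mul x y) v = lact x (lact y v);
  ractM : forall x y v, ract (kalg_mul x y) v = ract y (ract x v);
  lractA : forall x y v, ract y (lact x v) = lact x (ract y v)
}.

Record bimodule_algebra (k : comPzRingType) (A : kalgebra k) (V : lmodType k) :=
  BimoduleAlgebra {
  bimod_of :> bimodule A V;
  circ : V -> V -> V;
  circ_bilinear : is_bilinear circ;
  circ_assoc : forall u v w, circ (circ u v) w = circ u (circ v w);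
  lact_circ : forall x v w,
    lact bimod_of x (circ v w) = circ (lact bimod_of x v) w;
  ract_circ : forall x v w,
    ract bimod_of x (circ v w) = circ v (ract bimod_of x w);
  circ_mid : forall x v w,
    circ (ract bimod_of x v) w = circ v (lact bimod_of x w)
}.

Definition is_Oop_mod (k : comPzRingType) (A : kalgebra k) (V : lmodType k)
    (M : bimodule A V) (alpha : V -> A) : Prop :=
  forall u v : V,
    kalg_mul (alpha u) (alpha v) =
      alpha (lact M (alpha u) v) + alpha (ract M (alpha v) u).

Definition is_Oop_alg (k : comPzRingType) (lambda : k) (A : kalgebra k)
    (V : lmodType k) (R : bimodule_algebra A V) (alpha : V -> A) : Prop :=
  forall u v : V,
    kalg_mul (alpha u) (alpha v) =
      alpha (lact R (alpha u) v) + alpha (ract R (alpha v) u)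
        + lambda *: alpha (circ R u v).

(* The collections O^mod(V,-) and O^alg_lambda(V,-): the algebra A and the
   structure on V vary with the operator. *)
Record Omod (k : comPzRingType) (V : lmodType k) := OMod {
  omod_alg : kalgebra k;
  omod_bimod : bimodule omod_alg V;
  omod_map : {linear V -> omod_alg};
  omod_axiom : is_Oop_mod omod_bimod omod_map
}.

Record Oalg (k : comPzRingType) (lambda : k) (V : lmodType k) := OAlg {
  oalg_alg : kalgebra k;
  oalg_bimod : bimodule_algebra oalg_alg V;
  oalg_map : {linear V -> oalg_alg};
  oalg_axiom : is_Oop_alg lambda oalg_bimod oalg_map
}.

(* Dendriform structures on a fixed module; since the axioms are propositions,
   two structures are equal when their operations are. *)
Record DD (k : comPzRingType) (V : lmodType k) := Dendridi {
  dd_prec : V -> V -> V;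
  dd_succ : V -> V -> V;
  dd_star := fun x y => dd_prec x y + dd_succ x y;
  dd_prec_bilinear : is_bilinear dd_prec;
  dd_succ_bilinear : is_bilinear dd_succ;
  dd_ax1 : forall x y z, dd_prec (dd_prec x y) z = dd_prec x (dd_star y z);
  dd_ax2 : forall x y z, dd_prec (dd_succ x y) z = dd_succ x (dd_prec y z);
  dd_ax3 : forall x y z, dd_succ x (dd_succ y z) = dd_succ (dd_star x y) z
}.

Record DT (k : comPzRingType) (V : lmodType k) := Dendritri {
  dt_prec : V -> V -> V;
  dt_succ : V -> V -> V;
  dt_dot : V -> V -> V;
  dt_star := fun x y => dt_prec x y + dt_succ x y + dt_dot x y;
  dt_prec_bilinear : is_bilinear dt_prec;
  dt_succ_bilinear : is_bilinear dt_succ;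
  dt_dot_bilinear : is_bilinear dt_dot;
  dt_ax1 : forall x y z, dt_prec (dt_prec x y) z = dt_prec x (dt_star y z);
  dt_ax2 : forall x y z, dt_prec (dt_succ x y) z = dt_succ x (dt_prec y z);
  dt_ax3 : forall x y z, dt_succ (dt_star x y) z = dt_succ x (dt_succ y z);
  dt_ax4 : forall x y z, dt_dot (dt_succ x y) z = dt_succ x (dt_dot y z);
  dt_ax5 : forall x y z, dt_dot (dt_prec x y) z = dt_dot x (dt_succ y z);
  dt_ax6 : forall x y z, dt_prec (dt_dot x y) z = dt_dot x (dt_prec y z);
  dt_ax7 : forall x y z, dt_dot (dt_dot x y) z = dt_dot x (dt_dot y z)
}.

Section BilinearLemmas.
Variables (k : comPzRingType) (U V W : lmodType k) (f : U -> V -> W).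
Hypothesis f_bil : is_bilinear f.

Lemma is_bilinearDl u u' v : f (u + u') v = f u v + f u' v.
Proof. by have := f_bil.1 v 1 u u'; rewrite !scale1r. Qed.

Lemma is_bilinear_comp (U' : lmodType k) (g : {linear U' -> U}) :
  is_bilinear (fun u v => f (g u) v).
Proof.
split=> [v a u u'|u]; last exact: f_bil.2.
by rewrite linearP; apply: f_bil.1.
Qed.

Lemma is_bilinear_flip : is_bilinear (fun v u => f u v).
Proof. by split; [exact: f_bil.2 | exact: f_bil.1]. Qed.

End BilinearLemmas.

Section PhiMod.
Variables (k : comPzRingType) (V : lmodType k) (o : Omod V).

Definition omod_prec (u v : V) : V := ract (omod_bimod o) (omod_map o v) u.
Definition omod_succ (u v : V) : V := lact (omod_bimod o) (omod_map o u) v.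

Lemma omod_prec_bilinear : is_bilinear omod_prec.
Proof. exact/is_bilinear_flip/is_bilinear_comp/ract_bilinear. Qed.

Lemma omod_succ_bilinear : is_bilinear omod_succ.
Proof. exact/is_bilinear_comp/lact_bilinear. Qed.

Lemma omod_mapM u v :
  omod_map o (omod_prec u v + omod_succ u v) =
    kalg_mul (omod_map o u) (omod_map o v).
Proof. by rewrite (omod_axiom o u v) linearD addrC. Qed.

Lemma omod_ax1 x y z :
  omod_prec (omod_prec x y) z = omod_prec x (omod_prec y z + omod_succ y z).
Proof. by rewrite [RHS]/omod_prec omod_mapM ractM. Qed.

Lemma omod_ax2 x y z :
  omod_prec (omod_succ x y) z = omod_succ x (omod_prec y z).
Proof. exact: lractA. Qed.

Lemma omod_ax3 x y z :
  omod_succ x (omod_succ y z) = omod_succ (omod_prec x y + omod_succ x y) z.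
Proof. by rewrite [RHS]/omod_succ omod_mapM lactM. Qed.

Definition Phi_mod : DD V :=
  Dendridi omod_prec_bilinear omod_succ_bilinear omod_ax1 omod_ax2 omod_ax3.

End PhiMod.

Section PhiAlg.
Variables (k : comPzRingType) (V : lmodType k) (o : Oalg (1 : k) V).

Definition oalg_prec (u v : V) : V := ract (oalg_bimod o) (oalg_map o v) u.
Definition oalg_succ (u v : V) : V := lact (oalg_bimod o) (oalg_map o u) v.
Definition oalg_dot (u v : V) : V := circ (oalg_bimod o) u v.

Lemma oalg_prec_bilinear : is_bilinear oalg_prec.
Proof. exact/is_bilinear_flip/is_bilinear_comp/ract_bilinear. Qed.

Lemma oalg_succ_bilinear : is_bilinear oalg_succ.
Proof. exact/is_bilinear_comp/lact_bilinear. Qed.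

Lemma oalg_dot_bilinear : is_bilinear oalg_dot.
Proof. exact: circ_bilinear. Qed.

Lemma oalg_mapM u v :
  oalg_map o (oalg_prec u v + oalg_succ u v + oalg_dot u v) =
    kalg_mul (oalg_map o u) (oalg_map o v).
Proof.
by rewrite (oalg_axiom o u v) scale1r !linearD [X in X + _]addrC.
Qed.

Lemma oalg_ax1 x y z :
  oalg_prec (oalg_prec x y) z =
    oalg_prec x (oalg_prec y z + oalg_succ y z + oalg_dot y z).
Proof. by rewrite [RHS]/oalg_prec oalg_mapM ractM. Qed.

Lemma oalg_ax2 x y z :
  oalg_prec (oalg_succ x y) z = oalg_succ x (oalg_prec y z).
Proof. exact: lractA. Qed.

Lemma oalg_ax3 x y z :
  oalg_succ (oalg_prec x y + oalg_succ x y + oalg_dot x y) z =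
    oalg_succ x (oalg_succ y z).
Proof. by rewrite [LHS]/oalg_succ oalg_mapM lactM. Qed.

Lemma oalg_ax4 x y z : oalg_dot (oalg_succ x y) z = oalg_succ x (oalg_dot y z).
Proof. by rewrite /oalg_succ /oalg_dot lact_circ. Qed.

Lemma oalg_ax5 x y z : oalg_dot (oalg_prec x y) z = oalg_dot x (oalg_succ y z).
Proof. exact: circ_mid. Qed.

Lemma oalg_ax6 x y z : oalg_prec (oalg_dot x y) z = oalg_dot x (oalg_prec y z).
Proof. exact: ract_circ. Qed.

Lemma oalg_ax7 x y z : oalg_dot (oalg_dot x y) z = oalg_dot x (oalg_dot y z).
Proof. exact: circ_assoc. Qed.

Definition Phi_alg : DT V :=
  Dendritri oalg_prec_bilinear oalg_succ_bilinear oalg_dot_bilinear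
    oalg_ax1 oalg_ax2 oalg_ax3 oalg_ax4 oalg_ax5 oalg_ax6 oalg_ax7.

End PhiAlg.

Definition surjective (X Y : Type) (f : X -> Y) : Prop :=
  forall y : Y, exists x : X, f x = y.

(* Main.v *)
Require Import Defs.
From mathcomp Require Import all_boot all_algebra.
From Stdlib Require Import ProofIrrelevance.

(** Every dendriform structure on [V] comes from the identity of [V].  Let
    [star] be the sum of all the operations.  It is associative, by
    [dt_starA] and [dd_starA], so that [V] becomes an algebra [A].  The axioms
    that do not involve [dot], apart from its occurrence in [star], then say
    that [A] acts on the module [V], on the left by [succ] and on the right by
    [prec]; for a trialgebra, the remaining axioms say that [dot] makes [V] an
    [A]-bimodule algebra.  For [alpha := id] the operator identity reads
    [star u v = succ u v + prec u v], with the further summand [dot u v] when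
    [V] carries that product and the weight is [1]; this is the definition of
    [star].  The operations induced by this operator are the given ones.
    No enlargement of [V] is needed because the target algebra of an operator
    may be chosen freely. *)

Set Implicit Arguments.
Unset Strict Implicit.
Unset Printing Implicit Defensive.

Import GRing.Theory.
Local Open Scope ring_scope.

Section Bilinear.
Variables (k : comPzRingType) (U V W : lmodType k).
Implicit Types f g : U -> V -> W.

Lemma is_bilinearDr f (f_bil : is_bilinear f) u v v' :
  f u (v + v') = f u v + f u v'.
Proof. exact: (is_bilinearDl (is_bilinear_flip f_bil)). Qed.

Lemma is_bilinear_add f g : is_bilinear f -> is_bilinear g ->
  is_bilinear (fun u v => f u v + g u v).
Proof.
move=> [fl fr] [gl gr]; split=> [v|u] a x y.
  by rewrite fl gl scalerDr addrACA.
by rewrite fr gr scalerDr addrACA.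
Qed.

End Bilinear.

Section Trialgebra.
Variables (k : comPzRingType) (V : lmodType k).

Lemma DT_eq (S T : DT V) : dt_prec S = dt_prec T -> dt_succ S = dt_succ T ->
  dt_dot S = dt_dot T -> S = T.
Proof.
case: S => p s d ? ? ? ? ? ? ? ? ? ?.
case: T => p' s' d' ? ? ? ? ? ? ? ? ? ? /=.
by move=> *; subst p' s' d'; congr Dendritri; apply: proof_irrelevance.
Qed.

Variable T : DT V.

Lemma dt_star_bilinear : is_bilinear (dt_star T).
Proof.
apply: is_bilinear_add (dt_dot_bilinear T).
exact: is_bilinear_add (dt_prec_bilinear T) (dt_succ_bilinear T).
Qed.

(** The seven axioms add up to associativity: their left-hand sides sum to
    [star (star x y) z] and their right-hand sides to [star x (star y z)]. *)
Lemma dt_starA x y z : dt_star T (dt_star T x y) z = dt_star T x (dt_star T y z).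
Proof.
have starE u v : dt_star T u v = dt_prec T u v + dt_succ T u v + dt_dot T u v.
  by [].
(* Axioms 1 and 3 contain [star] and are used before it is expanded. *)
rewrite [LHS]starE [RHS]starE dt_ax3 -dt_ax1 !starE.
rewrite !(is_bilinearDl (dt_prec_bilinear T)).
rewrite !(is_bilinearDl (dt_dot_bilinear T)).
rewrite !(is_bilinearDr (dt_succ_bilinear T)).
rewrite !(is_bilinearDr (dt_dot_bilinear T)).
rewrite dt_ax2 dt_ax4 dt_ax5 dt_ax6 dt_ax7 -!addrA; do 2!congr (_ + _).
by rewrite addrCA; congr (_ + _); rewrite [X in _ + X]addrCA addrCA.
Qed.

Definition dt_alg : kalgebra k := KAlgebra dt_star_bilinear dt_starA.

Definition dt_bimodule : bimodule dt_alg V :=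
  @Bimodule k dt_alg V (dt_succ T) (fun x v => dt_prec T v x)
    (dt_succ_bilinear T) (is_bilinear_flip (dt_prec_bilinear T))
    (@dt_ax3 k V T) (fun x y v => esym (dt_ax1 T v x y))
    (fun x y v => dt_ax2 T x v y).

Definition dt_bimodule_algebra : bimodule_algebra dt_alg V :=
  @BimoduleAlgebra k dt_alg V dt_bimodule (dt_dot T) (dt_dot_bilinear T)
    (@dt_ax7 k V T) (fun x v w => esym (dt_ax4 T x v w))
    (fun x v w => dt_ax6 T v w x) (fun x v w => dt_ax5 T v x w).

Lemma dt_id_Oop :
  is_Oop_alg 1 dt_bimodule_algebra (idfun : {linear V -> dt_alg}).
Proof.
by move=> u v; rewrite scale1r /= /dt_star [dt_prec _ _ _ + _]addrC.
Qed.

Lemma Phi_alg_id : Phi_alg (OAlg dt_id_Oop) = T.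
Proof. exact: DT_eq. Qed.

End Trialgebra.

Section Dialgebra.
Variables (k : comPzRingType) (V : lmodType k).

Lemma DD_eq (C D : DD V) :
  dd_prec C = dd_prec D -> dd_succ C = dd_succ D -> C = D.
Proof.
case: C => p s ? ? ? ? ?; case: D => p' s' ? ? ? ? ? /=.
by move=> *; subst p' s'; congr Dendridi; apply: proof_irrelevance.
Qed.

Variable D : DD V.

Lemma dd_star_bilinear : is_bilinear (dd_star D).
Proof. exact: is_bilinear_add (dd_prec_bilinear D) (dd_succ_bilinear D). Qed.

(** As for [dt_starA], associativity is the sum of the three axioms. *)
Lemma dd_starA x y z : dd_star D (dd_star D x y) z = dd_star D x (dd_star D y z).
Proof.
have starE u v : dd_star D u v = dd_prec D u v + dd_succ D u v by [].
rewrite [LHS]starE [RHS]starE -dd_ax3 -dd_ax1 !starE.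
rewrite (is_bilinearDl (dd_prec_bilinear D)).
by rewrite (is_bilinearDr (dd_succ_bilinear D)) dd_ax2 addrA.
Qed.

Definition dd_alg : kalgebra k := KAlgebra dd_star_bilinear dd_starA.

Definition dd_bimodule : bimodule dd_alg V :=
  @Bimodule k dd_alg V (dd_succ D) (fun x v => dd_prec D v x)
    (dd_succ_bilinear D) (is_bilinear_flip (dd_prec_bilinear D))
    (fun x y v => esym (dd_ax3 D x y v)) (fun x y v => esym (dd_ax1 D v x y))
    (fun x y v => dd_ax2 D x v y).

Lemma dd_id_Oop : is_Oop_mod dd_bimodule (idfun : {linear V -> dd_alg}).
Proof. by move=> u v; rewrite /= /dd_star addrC. Qed.

Lemma Phi_mod_id : Phi_mod (OMod dd_id_Oop) = D.
Proof. exact: DD_eq. Qed.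

End Dialgebra.

Theorem theorem2p8 (k : comPzRingType) (V : lmodType k) :
  surjective (@Phi_alg k V) /\ surjective (@Phi_mod k V).
Proof.
split=> [T|D]; first by exists (OAlg (dt_id_Oop T)); apply: Phi_alg_id.
by exists (OMod (dd_id_Oop D)); apply: Phi_mod_id.
Qed.
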